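(* Let $(i,j)$ be an arc with $i,j\in\mathcal{I}$. For each customer $i\in\mathcal{I}$ let $\underline{k}^i:=\arg\min_{k\in\mathcal{K}}d_{ik}$ be the charging station yielding the minimum distance $\underline{d}_i=\min_{k\in\mathcal{K}} d_{ik}$ from customer $i$. If the electric vehicle reaches the threshold $Q^{T}$ under scenario $s\in\mathcal{S}$ while traversing arc $(i,j)$, then the quantity $$\max\{d_{ij},\ \underline{d}_i+\underline{d}_j\}$$ is a lower bound to the total length of any detour along arc $(i,j)$.
   Context: $\mathcal{I}$ is a finite set of customers, $\mathcal{K}$ a finite non-empty set of charging stations (CSs), and $\mathcal{S}$ a finite set of energy consumption scenarios. All customers and CSs are points of the Euclidean plane, and $d_{xy}$ denotes the Euclidean distance between points $x$ and $y$. Threshold recourse policy: an electric vehicle travels along the straight segment from $i$ to $j$; when its battery's state of charge drops to the threshold $Q^T$ at some point $f$ of this segment (the detour point, possibly $i$ itself), it goes directly from $f$ to some CS $k\in\mathcal{K}$, recharges there, and then goes directly from $k$ to $j$. A detour along arc $(i,j)$ thus consists of travelling from $i$ to the detour point $f$, from $f$ to a CS $k$, and from $k$ to $j$; its total length is $d_{if}+d_{fk}+d_{kj}$. The detour point $f$ depends on the scenario $s$, and the chosen CS $k$ may be any element of $\mathcal{K}$. *)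

(* Defs.v *)
From mathcomp Require Import all_boot all_order all_algebra.
From mathcomp Require Import reals.

Set Implicit Arguments.
Unset Strict Implicit.
Unset Printing Implicit Defensive.

Import Order.TTheory GRing.Theory Num.Theory.
Local Open Scope ring_scope.

(* The norm that MathComp puts on row vectors is the sup norm, so the Euclidean
   distance of the plane is spelled out. *)
Definition edist (R : realType) (x y : 'rV[R]_2) : R :=
  Num.sqrt (\sum_(c < 2) (x 0 c - y 0 c) ^+ 2).

Definition on_segment (R : realType) (a b x : 'rV[R]_2) : Prop :=
  exists2 t : R, 0 <= t <= 1 & x = (1 - t) *: a + t *: b.

(* Customers and stations are finite index types I and K with location maps pI
   and pK. The argument k0 witnesses that K is non-empty; the selected station
   does not depend on it. *)
Definition nearest_cs (R : realType) (I K : finType)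
    (pI : I -> 'rV[R]_2) (pK : K -> 'rV[R]_2) (k0 : K) (i : I) : K :=
  [arg min_(k < k0) edist (pI i) (pK k)]%O.

Definition nearest_dist (R : realType) (I K : finType)
    (pI : I -> 'rV[R]_2) (pK : K -> 'rV[R]_2) (k0 : K) (i : I) : R :=
  edist (pI i) (pK (nearest_cs pI pK k0 i)).

Lemma nearest_dist_le (R : realType) (I K : finType)
    (pI : I -> 'rV[R]_2) (pK : K -> 'rV[R]_2) (k0 : K) (i : I) (k : K) :
  nearest_dist pI pK k0 i <= edist (pI i) (pK k).
Proof.
by rewrite /nearest_dist /nearest_cs; case: arg_minP => // k1 _; apply.
Qed.

Lemma nearest_cs_indep (R : realType) (I K : finType)
    (pI : I -> 'rV[R]_2) (pK : K -> 'rV[R]_2) (k0 k1 : K) (i : I) :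
  nearest_cs pI pK k0 i = nearest_cs pI pK k1 i.
Proof.
rewrite /nearest_cs /Order.arg_min /extremum; case: pickP => // noP.
case: (@arg_minP _ _ _ k0 xpredT (fun k => edist (pI i) (pK k)) isT) => k _ kmin.
have /negP[] := negbT (noP k).
by apply/forallP => k'; apply: kmin.
Qed.

(* soc x is the state of charge at the point x of the segment from a to b while
   the vehicle drives straight from a to b. *)
Definition reaches_threshold (R : realType)
    (soc : 'rV[R]_2 -> R) (QT : R) (a b : 'rV[R]_2) : Prop :=
  exists2 x, on_segment a b x & soc x = QT.

(* The charge drops to QT at f: it equals QT at f and exceeds QT at every point
   passed before f. The case f = a is included. *)
Definition detour_point (R : realType)
    (soc : 'rV[R]_2 -> R) (QT : R) (a b f : 'rV[R]_2) : Prop :=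
  [/\ on_segment a b f,
      soc f = QT &
      forall x, on_segment a f x -> x != f -> QT < soc x].

Definition detour_length (R : realType) (a b f c : 'rV[R]_2) : R :=
  edist a f + edist f c + edist c b.

(* Main.v *)
Require Import Defs.
From mathcomp Require Import all_boot all_order all_algebra.
From mathcomp Require Import reals.
From mathcomp Require Import ring lra.

Import Order.TTheory GRing.Theory Num.Theory.
Local Open Scope ring_scope.

(** Both lower bounds are the triangle inequality for the Euclidean distance.
    A detour runs from [i] through [f] and [k] to [j], so it is at least as
    long as the segment from [i] to [j].  It also passes through the station
    [k]: the part from [i] to [k] is at least [d_ik], the part from [k] to [j]
    is [d_kj], and each of these is at least the distance from the customer to
    its nearest station ([nearest_dist_le]).  For the Euclidean distance the
    triangle inequality ([edist_triangle]) follows from Cauchy-Schwarz in two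
    coordinates ([sqrt_sum_sqrD_le]). *)

(** Squaring reduces the inequality to [a * c + b * d <= x * y], where [x] and
    [y] are the two roots on the right.  This is Cauchy-Schwarz, which squared
    is Lagrange's identity
    [x^2 * y^2 - (a * c + b * d)^2 = (a * d - b * c)^2]. *)
Lemma sqrt_sum_sqrD_le (R : rcfType) (a b c d : R) :
  Num.sqrt ((a + c) ^+ 2 + (b + d) ^+ 2) <=
  Num.sqrt (a ^+ 2 + b ^+ 2) + Num.sqrt (c ^+ 2 + d ^+ 2).
Proof.
set x := Num.sqrt (a ^+ 2 + b ^+ 2); set y := Num.sqrt (c ^+ 2 + d ^+ 2).
have x_ge0 : 0 <= x by exact: sqrtr_ge0.
have y_ge0 : 0 <= y by exact: sqrtr_ge0.
have x2 : x ^+ 2 = a ^+ 2 + b ^+ 2 by rewrite sqr_sqrtr // addr_ge0 ?sqr_ge0.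
have y2 : y ^+ 2 = c ^+ 2 + d ^+ 2 by rewrite sqr_sqrtr // addr_ge0 ?sqr_ge0.
have cauchy_schwarz : a * c + b * d <= x * y.
  apply: le_trans (ler_norm _) _.
  rewrite -ler_sqr ?nnegrE ?mulr_ge0 ?normr_ge0 // real_normK ?num_real //.
  rewrite exprMn x2 y2 -subr_ge0.
  have -> : (a ^+ 2 + b ^+ 2) * (c ^+ 2 + d ^+ 2) - (a * c + b * d) ^+ 2 =
            (a * d - b * c) ^+ 2 by ring.
  exact: sqr_ge0.
rewrite -[leRHS]ger0_norm ?addr_ge0 // -sqrtr_sqr ler_wsqrtr //.
rewrite [leRHS]sqrrD x2 y2.
lra.
Qed.

Lemma edistC (R : realType) (x y : 'rV[R]_2) : edist x y = edist y x.
Proof. by congr Num.sqrt; apply: eq_bigr => c _; rewrite -sqrrN opprB. Qed.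

Lemma edist_triangle (R : realType) (y x z : 'rV[R]_2) :
  edist x z <= edist x y + edist y z.
Proof.
have subD c : x 0 c - z 0 c = (x 0 c - y 0 c) + (y 0 c - z 0 c).
  by rewrite addrA subrK.
rewrite /edist !big_ord_recl !big_ord0 !addr0 !subD.
exact: sqrt_sum_sqrD_le.
Qed.

Theorem proposition2 (R : realType) (I K S : finType) (k0 : K)
    (pI : I -> 'rV[R]_2) (pK : K -> 'rV[R]_2)
    (QT : R) (soc : S -> 'rV[R]_2 -> R) (i j : I) (s : S) :
  reaches_threshold (soc s) QT (pI i) (pI j) ->
  forall (f : 'rV[R]_2) (k : K),
    detour_point (soc s) QT (pI i) (pI j) f ->
    Num.max (edist (pI i) (pI j))
            (nearest_dist pI pK k0 i + nearest_dist pI pK k0 j)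
      <= detour_length (pI i) (pI j) f (pK k).
Proof.
move=> _ f k _; rewrite /detour_length.
have i_f_k := edist_triangle _ f (pI i) (pK k).
rewrite ge_max; apply/andP; split.
  apply: le_trans (edist_triangle _ (pK k) _ _) _.
  by rewrite lerD2r.
apply: lerD.
  exact: le_trans (nearest_dist_le _ _ _ _ _) i_f_k.
by rewrite edistC nearest_dist_le.
Qed.
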